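(* In two dimensions one has \[ \rho^{(2)}=\tau^{(2)}_4\ge \frac{3}{5}\qquad\text{and}\qquad \tau^{(2)}_5\ge\frac{9}{13}. \]
   Context: For an integer $n\ge 2$, the kings graph $K[n,n]$ has vertex set $\{1,\ldots,n\}^2$; distinct vertices $v,u$ are neighbors if and only if $|v_i-u_i|\le 1$ for $i=1,2$. The toroidal kings graph $T[n,n]$ has the same vertex set, with coordinates read modulo $n$; distinct vertices $v,u$ are neighbors if and only if $v_i-u_i\equiv -1,0$ or $1\pmod n$ for $i=1,2$. (When $n=2$, neighbors in the toroidal graph are counted with multiplicity, the number of neighbors of $v$ in $S$ being the number of nonzero $y\in\{-1,0,1\}^2$ with $v+y\in S$.) In a graph $G$, $N(v)$ denotes the set of neighbors of $v$ (not including $v$). A set $S\subseteq V(G)$ is $k$-dependent if each vertex of $S$ has at most $k$ neighbors in $S$; it is half-dependent if $|S\cap N(v)|\le |N(v)|/2$ for each $v\in S$. Let $\beta_k(G)$ be the maximum cardinality of a $k$-dependent set in $G$ and $h(G)$ the maximum cardinality of a half-dependent set in $G$. Define $\tau^{(2)}_k=\lim_{n\to\infty}\beta_k(T[n,n])/n^2$ and $\rho^{(2)}=\lim_{n\to\infty}h(K[n,n])/n^2$ (these limits exist). *)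

(* Defs.v *)
From HB Require Import structures.
From mathcomp Require Import all_boot all_order all_algebra.
From mathcomp Require Import all_classical all_reals all_analysis.
From mathcomp Require Import zify.
Set Implicit Arguments.
Unset Strict Implicit.
Unset Printing Implicit Defensive.
Import Order.TTheory GRing.Theory Num.Theory.
Import numFieldNormedType.Exports.
Local Open Scope ring_scope.

(* A graph, possibly with multiple edges, is given by its edge multiplicity
   [m : V -> V -> nat]; for a simple graph [m] is 0/1-valued, and
   [neighbors_in m S v] is |S :&: N(v)| ([neighbors_in_simple]). *)
Section Dependence.
Variables (V : finType) (m : V -> V -> nat).
Implicit Types (S : {set V}) (v : V).

Definition neighbors_in S v : nat := (\sum_(u in S) m v u)%N.

Definition k_dependent (k : nat) S : bool :=
  [forall v in S, (neighbors_in S v <= k)%N].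

(* |S :&: N(v)| <= |N(v)| / 2 as rationals, multiplied out *)
Definition half_dependent S : bool :=
  [forall v in S, (2 * neighbors_in S v <= neighbors_in [set: V] v)%N].

Definition beta (k : nat) : nat := \max_(S : {set V} | k_dependent k S) #|S|.

Definition hmax : nat := \max_(S : {set V} | half_dependent S) #|S|.

End Dependence.

Lemma neighbors_in_simple (V : finType) (e : rel V) (S : {set V}) (v : V) :
  neighbors_in (fun x y => e x y : nat) S v = #|S :&: [set u | e v u]|.
Proof.
rewrite /neighbors_in -sum1_card big_mkcond [RHS]big_mkcond /=.
by apply: eq_bigr => u _; rewrite !inE; case: (u \in S); case: (e v u).
Qed.

(* The coordinates run over {0, ..., n-1} instead of {1, ..., n}. *)
Definition grid (n : nat) : finType := ('I_n * 'I_n)%type.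

Definition kings_adj (n : nat) : rel (grid n) := fun v u =>
  [&& v != u, `|v.1%:Z - u.1%:Z| <= 1 & `|v.2%:Z - u.2%:Z| <= 1].

Definition kings (n : nat) (v u : grid n) : nat := kings_adj v u.

Definition unit_steps : seq int := [:: -1; 0; 1].

Definition torus_adj (n : nat) : rel (grid n) := fun v u =>
  [&& v != u,
      has (fun a => (v.1%:Z - u.1%:Z == a %[mod n%:Z])%Z) unit_steps
    & has (fun a => (v.2%:Z - u.2%:Z == a %[mod n%:Z])%Z) unit_steps].

Definition king_steps : seq (int * int) :=
  [seq y <- [seq (a, b) | a <- unit_steps, b <- unit_steps] | y != (0, 0)].

(* Number of nonzero y in {-1, 0, 1}^2 with v + y = u modulo n. For n > 1 it
   is positive exactly on [torus_adj] ([torus_gt0]), and for n > 2 it is at most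
   1 ([torusE]); for n = 2 several steps y lead from v to the same u. *)
Definition torus (n : nat) (v u : grid n) : nat :=
  count (fun y => (v.1%:Z + y.1 == u.1%:Z %[mod n%:Z])%Z
               && (v.2%:Z + y.2 == u.2%:Z %[mod n%:Z])%Z) king_steps.

Section TorusMultiplicity.
Variable n : nat.
Let p (i j : 'I_n) (a : int) : bool := (i%:Z + a == j%:Z %[mod n%:Z])%Z.

Let torus_count (v u : grid n) :
  torus v u = count (fun y => p v.1 u.1 y.1 && p v.2 u.2 y.2) king_steps.
Proof. by []. Qed.

Let adj_count (v u : grid n) : torus_adj v u =
  [&& v != u, has (p v.1 u.1) unit_steps & has (p v.2 u.2) unit_steps].
Proof.
have pN (i j : 'I_n) a :
    (i%:Z - j%:Z == a %[mod n%:Z])%Z = p i j (- a).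
  by rewrite /p !eqz_mod_dvd addrAC.
by rewrite /torus_adj /= !pN opprK oppr0 !orbF; congr [&& _, _ & _];
  case: (p _ _ (-1)); case: (p _ _ 0); case: (p _ _ 1).
Qed.

Let p0 (i j : 'I_n) : p i j 0 = (i == j).
Proof.
by rewrite /p addr0 !modz_nat eqz_nat !modn_small.
Qed.

Let p_uniq (i j : 'I_n) (a b : int) : (2 < n)%N ->
  a \in unit_steps -> b \in unit_steps -> p i j a -> p i j b -> a = b.
Proof.
move=> n_gt2; rewrite /p => aS bS /eqP pa /eqP pb.
have : (n%:Z %| a - b)%Z.
  by rewrite -eqz_mod_dvd -(eqz_modDl i%:Z) pa pb.
move=> /dvdzP[c abE].
have : `|a - b| <= 2.
  by move: aS bS; rewrite !inE => /or3P[] /eqP-> /or3P[] /eqP->.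
rewrite abE normrM => c_le; apply/eqP; rewrite -subr_eq0 abE mulf_eq0.
by apply/orP; left; move: c_le; case: (c =P 0) => // ?; nia.
Qed.

Lemma torus_gt0 (v u : grid n) : (1 < n)%N ->
  (0 < torus v u)%N = torus_adj v u.
Proof.
move=> n_gt1; rewrite adj_count torus_count -has_count.
have p1 (i : 'I_n) : (p i i 1 = false) * (p i i (-1) = false).
  rewrite /p !eqz_mod_dvd addrC addKr addrC addKr.
  by rewrite !dvdzE /= !dvdn1; split; apply/negbTE; rewrite neq_ltn n_gt1 orbT.
have -> : (v != u) = ~~ (p v.1 u.1 0 && p v.2 u.2 0) by rewrite !p0.
rewrite /= !orbF.
have /implyP h1 : p v.1 u.1 0 -> ~~ p v.1 u.1 1 && ~~ p v.1 u.1 (-1).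
  by rewrite p0 => /eqP->; rewrite !p1.
have /implyP h2 : p v.2 u.2 0 -> ~~ p v.2 u.2 1 && ~~ p v.2 u.2 (-1).
  by rewrite p0 => /eqP->; rewrite !p1.
by move: h1 h2; do 6!case: (p _ _ _).
Qed.

Lemma torusE (v u : grid n) : (2 < n)%N -> torus v u = torus_adj v u.
Proof.
move=> n_gt2; have := torus_gt0 v u (ltnW n_gt2).
suff : (torus v u <= 1)%N by case: torus => [|[]] // _ <-.
rewrite torus_count /=.
have h (i j : 'I_n) : (p i j (-1) + (p i j 0 + p i j 1) <= 1)%N.
  have u1 := @p_uniq i j (-1) 0 n_gt2 isT isT.
  have u2 := @p_uniq i j (-1) 1 n_gt2 isT isT.
  have u3 := @p_uniq i j 0 1 n_gt2 isT isT.
  by move: u1 u2 u3; do 3!case: (p _ _ _) => //=; do ?[by move=> /(_ isT isT)];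
    do ?[by move=> _ /(_ isT isT)]; do ?[by move=> _ _ /(_ isT isT)].
move: (h v.1 u.1) (h v.2 u.2).
by do 6!case: (p _ _ _).
Qed.

End TorusMultiplicity.

(* The terms n = 0, 1 are irrelevant to the limits below. *)
Definition tau_seq (R : realType) (k : nat) : R^nat :=
  fun n => (beta (@torus n) k)%:R / n%:R ^+ 2.

Definition rho_seq (R : realType) : R^nat :=
  fun n => (hmax (@kings n))%:R / n%:R ^+ 2.

Definition tau (R : realType) (k : nat) : R := limn (tau_seq R k).

Definition rho (R : realType) : R := limn (rho_seq R).

(* Main.v *)
Require Import Defs.
From mathcomp Require Import all_boot all_order all_algebra.
From mathcomp Require Import all_classical all_reals all_analysis.
From mathcomp Require Import zify ring.
Set Implicit Arguments.
Unset Strict Implicit.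
Unset Printing Implicit Defensive.
Import Order.TTheory GRing.Theory Num.Theory.
Import numFieldNormedType.Exports.
Local Open Scope ring_scope.

(** Everything is compared with a single family of numbers: the largest size
    a k n of a k-dependent set in the kings graph on an n by n board.

    Cutting the board of side n <= q m into q^2 blocks of side at most m cuts a
    k-dependent set into k-dependent pieces, so a k n <= q^2 (a k m)
    ([beta_kings_blocks]).  As in Fekete's lemma, this forces a k n / n^2 to
    converge to its infimum ([cvg_density]).

    The torus and the half-dependent sets differ from this only at the border.
    The torus has more edges than the board, and a board with one empty row and
    one empty column added no longer feels the wrap-around, so the torus number
    for k satisfies a k n <= beta (torus (n + 1)) k <= a k (n + 1).  A vertex
    has at most 8 neighbors, so a half-dependent set is 4-dependent; a vertex
    off the border has exactly 8, so a 4-dependent set surrounded by an empty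
    frame is half-dependent.  Hence a 4 n <= hmax (kings (n + 2)) <= a 4 (n + 2).
    Shifting the side by a constant does not change the limit of the density
    ([cvg_density_sandwich]); this gives all the convergences and the equality
    of rho with tau 4.

    For the lower bounds, color the cell (i, j) by t + i a + j b in a finite
    abelian group F, and keep the cells whose color lies in a subset C of F.
    How many neighbors of a kept cell are kept depends on its color only, and
    the average over t of the number of kept cells is n^2 |C| / |F|
    ([leq_beta_coloring]).  The densities 3/5 and 9/13 come from suitable
    subsets of the integers modulo 5 and 13. *)

(** * Dependent sets and maps of graphs *)

(** Injectivity is local to S because it will serve to move one block of a large
    board onto a small board, by a map that identifies different blocks. *)
Lemma neighbors_in_imset (V W : finType) (mV : V -> V -> nat)
    (mW : W -> W -> nat) (f : V -> W) (S : {set V}) (v : V) :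
  {in S &, injective f} ->
  {in S &, forall v u, (mW (f v) (f u) <= mV v u)%N} ->
  v \in S -> (neighbors_in mW (f @: S) (f v) <= neighbors_in mV S v)%N.
Proof.
move=> f_inj f_le vS; rewrite /neighbors_in big_imset //=.
by apply: leq_sum => u uS; exact: f_le.
Qed.

Lemma k_dependent_imset (V W : finType) (mV : V -> V -> nat)
    (mW : W -> W -> nat) (f : V -> W) (k : nat) (S : {set V}) :
  {in S &, injective f} ->
  {in S &, forall v u, (mW (f v) (f u) <= mV v u)%N} ->
  k_dependent mV k S -> k_dependent mW k (f @: S).
Proof.
move=> f_inj f_le /forall_inP S_dep; apply/forall_inP => _ /imsetP[v vS ->].
exact: leq_trans (neighbors_in_imset f_inj f_le vS) (S_dep v vS).
Qed.

Lemma neighbors_in_subset (V : finType) (m : V -> V -> nat) (S T : {set V}) v :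
  S \subset T -> (neighbors_in m S v <= neighbors_in m T v)%N.
Proof.
move=> /fintype.subsetP ST; rewrite /neighbors_in big_mkcond [leqRHS]big_mkcond /=.
by apply: leq_sum => u _; case: ifP => // /ST ->.
Qed.

Lemma k_dependent_subset (V : finType) (m : V -> V -> nat) k (S T : {set V}) :
  S \subset T -> k_dependent m k T -> k_dependent m k S.
Proof.
move=> ST /forall_inP T_dep; apply/forall_inP => v vS.
by rewrite (leq_trans (neighbors_in_subset m v ST)) ?T_dep ?(fintype.subsetP ST).
Qed.

Lemma leq_beta (V : finType) (m : V -> V -> nat) k (S : {set V}) :
  k_dependent m k S -> (#|S| <= beta m k)%N.
Proof. exact: (leq_bigmax_cond (F := fun S : {set V} => #|S|)). Qed.

Lemma beta_imset (V W : finType) (mV : V -> V -> nat) (mW : W -> W -> nat)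
    (f : V -> W) (k : nat) :
  injective f -> (forall v u, (mW (f v) (f u) <= mV v u)%N) ->
  (beta mV k <= beta mW k)%N.
Proof.
move=> f_inj f_le; apply/bigmax_leqP => S S_dep.
rewrite -(card_imset (mem S) f_inj); apply: leq_beta.
by by apply: k_dependent_imset S_dep => // v u _ _; exact: f_inj.
Qed.

(** * Neighbors in the kings graph *)

Lemma grid_eqE (n : nat) (v u : grid n) :
  (v == u) = (v.1%:Z == u.1%:Z) && (v.2%:Z == u.2%:Z).
Proof. by case: v u => [v1 v2] [u1 u2]; rewrite xpair_eqE -!val_eqE !eqz_nat. Qed.

(** Adjacency depends on coordinate differences only, even across boards of
    different sides; this is what makes all the boards comparable. *)
Lemma kings_translate (n m : nat) (v u : grid n) (v' u' : grid m) :
  v.1%:Z - u.1%:Z = v'.1%:Z - u'.1%:Z -> v.2%:Z - u.2%:Z = v'.2%:Z - u'.2%:Z ->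
  kings v u = kings v' u'.
Proof.
rewrite /kings /kings_adj => e1 e2; rewrite e1 e2.
congr (nat_of_bool (~~ _ && _)).
rewrite !grid_eqE -(subr_eq0 (Posz v.1)) -(subr_eq0 (Posz v.2)) e1 e2.
by rewrite !subr_eq0.
Qed.

Definition reaches (n : nat) (v : grid n) (y : int * int) (u : grid n) : bool :=
  (v.1%:Z + y.1 == u.1%:Z) && (v.2%:Z + y.2 == u.2%:Z).

(** This is the analogue, without reduction modulo n, of the count defining
    the torus; it makes the two graphs directly comparable. *)
Lemma kings_count (n : nat) (v u : grid n) :
  kings v u = count (fun y => reaches v y u) king_steps.
Proof.
pose d := (u.1%:Z - v.1%:Z, u.2%:Z - v.2%:Z).
have reachesE y : reaches v y u = pred1 d y.
  by case: y => a b; rewrite /reaches /d /= xpair_eqE; lia.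
rewrite (eq_count reachesE) count_uniq_mem //; congr nat_of_bool.
have step_le (a : int) : (a \in unit_steps) = (`|a| <= 1) by rewrite !inE; lia.
have -> : (d \in king_steps) =
    [&& d != 0, d.1 \in unit_steps & d.2 \in unit_steps].
  rewrite mem_filter; congr (_ && _).
  apply/allpairsP/andP => [[[a b] [aS bS ->]] | []] //.
  by exists d; split=> //; case: d.
by rewrite !step_le /kings_adj /d grid_eqE xpair_eqE /=; lia.
Qed.

Lemma neighbors_in_kings (n : nat) (S : {set grid n}) (v : grid n) :
  neighbors_in (@kings n) S v =
  count (fun y => [exists u in S, reaches v y u]) king_steps.
Proof.
rewrite /neighbors_in -sum1_count [RHS]big_mkcond /=.
under eq_bigr do rewrite kings_count -sum1_count big_mkcond /=.
rewrite exchange_big /=; apply: eq_bigr => y _; rewrite -big_mkcondr sum1_card.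
case: ifP => [/exists_inP[u uS vyu] | /exists_inPn no_u].
  rewrite (fintype.eq_card1 (x := u)) // => w; rewrite inE unfold_in /=.
  have [-> | neq_wu] := eqVneq w u; first by rewrite uS.
  apply: contra_neqF neq_wu => /andP[_ vyw]; apply/eqP; move: vyu vyw.
  rewrite grid_eqE => /andP[/eqP<- /eqP<-] /andP[/eqP<- /eqP<-].
  by rewrite !eqxx.
apply: fintype.eq_card0 => u; rewrite inE unfold_in /=.
by case: (boolP (u \in S)) => // /no_u /negPf.
Qed.

(** * Comparing kings graphs, torus and half-dependent sets *)

(** Half of the at most 8 neighbors of a cell is at most 4. *)
Lemma hmax_le_beta (n : nat) : (hmax (@kings n) <= beta (@kings n) 4)%N.
Proof.
apply/bigmax_leqP => S /forall_inP S_half; apply: leq_beta.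
apply/forall_inP => v /S_half; rewrite [X in (_ <= X)%N]neighbors_in_kings.
move=> /leq_trans/(_ (count_size _ _)).
by rewrite -[size _]/(2 * 4)%N leq_pmul2l.
Qed.

(** Inside an empty frame of width 1, every vertex has all of its 8 neighbors,
    so half-dependence there means 4-dependence. *)
Lemma beta_le_hmax (n : nat) :
  (beta (@kings n) 4 <= hmax (@kings n.+2))%N.
Proof.
have ltS (i : 'I_n) : (i.+1 < n.+2)%N by have := ltn_ord i; lia.
pose f (v : grid n) : grid n.+2 := (Ordinal (ltS v.1), Ordinal (ltS v.2)).
have f_inj : injective f.
  by move=> [v1 v2] [u1 u2] [e1 e2]; congr (_, _); exact: val_inj.
have f_kings v u : kings (f v) (f u) = kings v u.
  by apply: kings_translate => /=; lia.
apply/bigmax_leqP => S /forall_inP S_dep; rewrite -(card_imset (mem S) f_inj).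
apply: (leq_bigmax_cond (F := fun S : {set grid n.+2} => #|S|)).
apply/forall_inP => _ /imsetP[v vS ->].
apply: (@leq_trans 8).
  rewrite (_ : 8 = 2 * 4)%N // leq_pmul2l //; apply: leq_trans (S_dep v vS).
  apply: neighbors_in_imset => // [u w _ _ | u w _ _]; first exact: f_inj.
  by rewrite f_kings.
rewrite neighbors_in_kings.
suff : all (fun y => [exists u in [set: grid n.+2], reaches (f v) y u])
  king_steps by rewrite all_count => /eqP->.
have reach (a b : int) : `|a| <= 1 -> `|b| <= 1 ->
    [exists u in [set: grid n.+2], reaches (f v) (a, b) u].
  move=> a1 b1; apply/exists_inP.
  exists (inord (absz (v.1.+1%:Z + a)), inord (absz (v.2.+1%:Z + b))); rewrite ?inE //.
  rewrite /reaches /=; case: v {vS} => [[v1 lt1] [v2 lt2]] /=.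
  by rewrite !inordK; lia.
by rewrite /= !reach.
Qed.

(** A step that works without wrap-around still works modulo n. *)
Lemma beta_torus_le (n k : nat) : (1 < n)%N ->
  (beta (@torus n) k <= beta (@kings n) k)%N.
Proof.
move=> n_gt1; apply: (beta_imset (f := id)) => // v u.
rewrite kings_count; apply: sub_count => y /andP[/eqP-> /eqP->].
by rewrite !eqxx.
Qed.

(** With one spare row and column, two cells of the board that are adjacent on
    the torus have differences smaller than n in absolute value and congruent
    to -1, 0 or 1 modulo n + 1, hence are adjacent on the board. *)
Lemma beta_le_torus (n k : nat) : (1 < n)%N ->
  (beta (@kings n) k <= beta (@torus n.+1) k)%N.
Proof.
move=> n_gt1; pose f (v : grid n) : grid n.+1 :=
  (widen_ord (leqnSn n) v.1, widen_ord (leqnSn n) v.2).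
apply: (beta_imset (f := f)) => [[v1 v2] [u1 u2] [e1 e2] | v u].
  by congr (_, _); exact: val_inj.
rewrite torusE // /kings; case: (boolP (torus_adj _ _)) => // /and3P[vu h1 h2].
have small (i j : 'I_n) :
    has (fun a => (i%:Z - j%:Z == a %[mod n.+1%:Z])%Z) unit_steps ->
    `|i%:Z - j%:Z| <= 1.
  case/hasP => a; rewrite !inE eqz_mod_dvd => a1 /dvdzP[c].
  have := ltn_ord i; have := ltn_ord j.
  by case/or3P: a1 => /eqP->; case: (ltrgtP c 0) => ? *; nia.
rewrite lt0b /kings_adj (small _ _ h1) (small _ _ h2) !andbT.
by apply: contra_neq vu => ->.
Qed.

(** The subadditivity behind the existence of the limits: each of the
    q^2 blocks of the partition contributes at most the optimum for side m. *)
Lemma beta_kings_blocks (n m q k : nat) : (0 < m)%N -> (n <= q * m)%N ->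
  (beta (@kings n) k <= q ^ 2 * beta (@kings m) k)%N.
Proof.
move=> m_gt0 n_le; apply/bigmax_leqP => S S_dep.
have lt_q (i : 'I_n) : (i %/ m < q)%N.
  by rewrite ltn_divLR // (leq_trans (ltn_ord i)).
have lt_m (i : nat) : (i %% m < m)%N by rewrite ltn_pmod.
pose block (v : grid n) : grid q := (Ordinal (lt_q v.1), Ordinal (lt_q v.2)).
pose pos (v : grid n) : grid m := (Ordinal (lt_m v.1), Ordinal (lt_m v.2)).
rewrite -sum1_card (partition_big block xpredT) //=.
apply: (@leq_trans (\sum_(b : grid q) beta (@kings m) k)); last first.
  by rewrite sum_nat_const card_prod card_ord.
apply: leq_sum => b _; rewrite sum1_card.
pose Sb := [set v in S | block v == b].
have SbP v u : v \in Sb -> u \in Sb ->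
    (v.1 %/ m = u.1 %/ m)%N /\ (v.2 %/ m = u.2 %/ m)%N.
  by rewrite !inE => /andP[_ /eqP<-] /andP[_ /eqP[-> ->]].
have ord_inj_divmod (i j : 'I_n) :
    (i %/ m = j %/ m)%N -> (i %% m = j %% m)%N -> i = j.
  by move=> d e; apply: val_inj; rewrite /= (divn_eq i m) d e -divn_eq.
have modn_sub (i j : nat) :
    (i %/ m = j %/ m)%N -> (i %% m)%:Z - (j %% m)%:Z = i%:Z - j%:Z.
  by move=> d; rewrite [i in RHS](divn_eq i m) [j in RHS](divn_eq j m) d; lia.
have pos_inj : {in Sb &, injective pos}.
  move=> [v1 v2] [u1 u2] vS uS [e1 e2]; have [/= d1 d2] := SbP _ _ vS uS.
  by congr (_, _); exact: ord_inj_divmod.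
rewrite (_ : #|_| = #|Sb|); last by apply: eq_card => v; rewrite !inE.
rewrite -(card_in_imset pos_inj); apply: leq_beta.
apply: k_dependent_imset pos_inj _ (k_dependent_subset _ S_dep).
  move=> v u vS uS; have [d1 d2] := SbP _ _ vS uS.
  by rewrite (kings_translate (v' := v) (u' := u)) //=; exact: modn_sub.
by apply/fintype.subsetP => v; rewrite inE => /andP[].
Qed.


(** * Periodic patterns *)

(** The hypothesis looks at an unbounded board; on the finite board, border
    cells only lose neighbors.  Averaging over the shift t gives the
    bound for every side n, not only for multiples of the period. *)
Lemma leq_beta_coloring (F : finZmodType) (a b : F) (C : seq F) (n k : nat) :
  uniq C ->
  (forall r, r \in C ->
     count (fun y => (r + a *~ y.1 + b *~ y.2)%R \in C) king_steps <= k)%N ->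
  (size C * n ^ 2 <= #|F| * beta (@kings n) k)%N.
Proof.
move=> C_uniq C_dep; pose color (v : grid n) := a *+ v.1 + b *+ v.2.
pose S t := [set v : grid n | t + color v \in C].
have S_dep t : k_dependent (@kings n) k (S t).
  apply/forall_inP => v; rewrite inE => /C_dep; apply: leq_trans.
  rewrite neighbors_in_kings; apply: sub_count => y /exists_inP[u].
  rewrite inE => uC /andP[/eqP y1 /eqP y2]; move: uC.
  congr (is_true (_ \in C)); rewrite /color !pmulrn -y1 -y2 !mulrzDr.
  by rewrite addrACA !addrA.
(* Double counting: each cell is kept by exactly |C| of the shifts t. *)
have <- : (\sum_t #|S t| = size C * n ^ 2)%N.
  under eq_bigr => t _ do rewrite -sum1_card big_mkcond /=.
  rewrite exchange_big /= (eq_bigr (fun=> size C)); last first.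
    move=> v _; rewrite -(card_uniqP C_uniq) -sum1_card [RHS]big_mkcond /=.
    rewrite [RHS](reindex_inj (addIr (color v))) /=.
    by apply: eq_bigr => t _; rewrite inE.
  by rewrite sum_nat_const card_prod card_ord mulnC.
by rewrite -sum_nat_const; apply: leq_sum => t _; exact: leq_beta.
Qed.

(** With colors i + 2 j modulo 5, the eight steps change the color by each of
    1, 2, 3, 4 exactly twice.  So any three colors will do: each cell kept
    has two neighbors of each of the other two colors. *)
Lemma beta4_ge (n : nat) : (3 * n ^ 2 <= 5 * beta (@kings n) 4)%N.
Proof.
have := @leq_beta_coloring 'Z_5 1 2 [:: 0; 1; 2] n 4 isT.
by rewrite card_ord; apply; apply/allP; vm_compute.
Qed.

(** With colors i + 5 j modulo 13, the horizontal and vertical steps change the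
    color by the elements of H = {1, 5, 8, 12}, the subgroup of order 4 of the
    units, and the diagonal steps by those of the coset 4 H = {4, 6, 7, 9}.  The
    colors kept are 0, H and 2 H; the colors dropped are 4 H.  The whole pattern
    is invariant under H, and a cell of color 0, 1 or 2 has respectively 4, 3
    and 3 neighbors whose color is in 4 H, so at most 5 of its neighbors are
    kept. *)
Lemma beta5_ge (n : nat) : (9 * n ^ 2 <= 13 * beta (@kings n) 5)%N.
Proof.
have := @leq_beta_coloring 'Z_13 1 5 [:: 0; 1; 5; 8; 12; 2; 10; 3; 11] n 5 isT.
by rewrite card_ord; apply; apply/allP; vm_compute.
Qed.

(** * Limits of densities *)

Section Density.
Local Open Scope classical_set_scope.
Variable R : realType.

Definition density (a : nat -> nat) : R^nat := fun n => (a n)%:R / n%:R ^+ 2.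

Lemma cvg_natV : (fun n : nat => n%:R^-1 : R) @ \oo --> (0 : R).
Proof.
rewrite -(cvg_shiftn 1); under eq_fun do rewrite addn1.
exact: cvg_harmonic.
Qed.

Lemma cvg_sqrM1 (r u : R^nat) (l : R) :
  r @ \oo --> (1 : R) -> u @ \oo --> l ->
  (fun n => r n ^+ 2 * u n) @ \oo --> l.
Proof.
move=> r1 ul; rewrite -(mul1r l) -[X in X * l](mul1r 1).
by under eq_fun do rewrite expr2; apply: cvgM => //; exact: cvgM.
Qed.

Lemma cvg_mul_natV (c : R) : (fun n : nat => c * n%:R^-1) @ \oo --> (0 : R).
Proof. by rewrite -(mulr0 c); apply: cvgM; [exact: cvg_cst | exact: cvg_natV]. Qed.

(** The quantitative form of the hypothesis of [cvg_density]: n is covered by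
    the multiple q m of m, where q = n / m + 1, and q m <= n + m. *)
Lemma density_le_block (a : nat -> nat) (n m : nat) :
  (forall q, (n <= q * m)%N -> (a n <= q ^ 2 * a m)%N) ->
  (0 < n)%N -> (0 < m)%N ->
  density a n <= (1 + m%:R / n%:R) ^+ 2 * density a m.
Proof.
move=> a_sub n_gt0 m_gt0; pose q := (n %/ m).+1.
have n_le : (n <= q * m)%N by rewrite ltnW // ltn_ceil.
have qm_le : (q * m <= n + m)%N by rewrite mulSn addnC leq_add2r leq_divM.
have n0 : (n%:R : R) != 0 by rewrite pnatr_eq0 -lt0n.
have m0 : (m%:R : R) != 0 by rewrite pnatr_eq0 -lt0n.
apply: (@le_trans _ _ (((q * m)%:R / n%:R) ^+ 2 * density a m)).
  rewrite [leRHS](_ : _ = (q ^ 2 * a m)%:R / n%:R ^+ 2).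
    by rewrite ler_wpM2r ?ler_nat ?a_sub // invr_ge0 exprn_ge0.
  by rewrite /density !natrM; field; rewrite n0.
rewrite ler_wpM2r ?divr_ge0 ?exprn_ge0 // lerXn2r ?nnegrE ?addr_ge0 ?divr_ge0 //.
have -> : 1 + m%:R / n%:R = (n + m)%:R / n%:R :> R by rewrite natrD; field.
by rewrite ler_wpM2r ?ler_nat ?invr_ge0.
Qed.

(** The two-dimensional Fekete lemma; the limit is the infimum over positive
    sides, because a block of side m with nearly minimal density bounds the
    density for all large n. *)
Lemma cvg_density (a : nat -> nat) :
  (forall n m q, (0 < m)%N -> (n <= q * m)%N -> (a n <= q ^ 2 * a m)%N) ->
  cvgn (density a).
Proof.
move=> a_sub; pose E := [set density a m | m in [set m | (0 < m)%N]]%classic.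
have E_inf : has_inf E.
  split; first by exists (density a 1%N), 1%N.
  by exists 0 => _ [m _ <-]; rewrite divr_ge0 ?exprn_ge0.
apply/cvg_ex; exists (inf E); apply/cvgrPdist_le => e e_gt0.
have [_ [m /= m_gt0 <-] m_near] := inf_adherent e_gt0 E_inf.
have m_cvg : (fun n => (1 + m%:R / n%:R) ^+ 2 * density a m) @ \oo --> density a m.
  apply: cvg_sqrM1; last exact: cvg_cst.
  rewrite -[X in _ --> X](addr0 1).
  by apply: cvgD; [exact: cvg_cst | exact: cvg_mul_natV].
near=> n.
have n_gt0 : (0 < n)%N by near: n; exact: nbhs_infty_gt.
have inf_le : inf E <= density a n by apply: ge_inf; [case: E_inf | exists n].
rewrite distrC ger0_norm ?subr_ge0 // lerBlDl.
apply: le_trans (density_le_block _ n_gt0 m_gt0) _ => [q|]; first exact: a_sub.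
by near: n; exact: cvgr_le m_cvg _ m_near.
Unshelve. all: by end_near. Qed.

(** Adding j to the side multiplies the area by a factor that tends to 1, so a
    sequence caught between a and its shift has the same limiting density. *)
Lemma cvg_density_sandwich (a c : nat -> nat) (j : nat) (l : R) :
  (forall n, (1 < n)%N -> (c n <= a n <= c (n + j))%N) ->
  density a @ \oo --> l -> density c @ \oo --> l.
Proof.
move=> ca a_cvg; rewrite -(cvg_shiftn j).
(* r n = n / (n + j) for n > 0, in a form whose limit is immediate *)
pose r n : R := 1 - j%:R * (n + j)%:R^-1.
apply: (@squeeze_cvgr _ _ _ _ (fun n => r n ^+ 2 * density a n)
  (fun n => density a (n + j)%N)).
- near=> n.
  have n_gt1 : (1 < n)%N by near: n; exact: nbhs_infty_gt.
  have nj_gt1 : (1 < n + j)%N by rewrite ltn_addr.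
  have n0 : (n%:R : R) != 0 by rewrite pnatr_eq0 -lt0n ltnW.
  have nj0 : ((n + j)%:R : R) != 0 by rewrite pnatr_eq0 -lt0n ltnW.
  have -> : r n ^+ 2 * density a n = (a n)%:R / (n + j)%:R ^+ 2.
    rewrite /r /density; move: nj0; rewrite natrD => nj0; field.
    by rewrite nj0.
  have /andP[_ a_le] := ca _ n_gt1; have /andP[c_le _] := ca _ nj_gt1.
  by rewrite !ler_wpM2r ?ler_nat ?invr_ge0 ?exprn_ge0.
- apply: cvg_sqrM1 => //; rewrite -[X in _ --> X](subr0 1).
  apply: cvgB; first exact: cvg_cst.
  rewrite (cvg_shiftn j (fun n : nat => j%:R * n%:R^-1 : R)).
  exact: cvg_mul_natV.
- by rewrite cvg_shiftn.
Unshelve. all: by end_near. Qed.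

Lemma density_ge (a : nat -> nat) (s p : nat) : (0 < p)%N ->
  (forall n, s * n ^ 2 <= p * a n)%N -> cvgn (density a) ->
  s%:R / p%:R <= limn (density a).
Proof.
move=> p_gt0 a_ge a_cvg; apply: limr_ge => //; near=> n.
have n_gt0 : (0 < n)%N by near: n; exact: nbhs_infty_gt.
rewrite ler_pdivrMr ?ltr0n // mulrAC ler_pdivlMr ?exprn_gt0 ?ltr0n //.
by rewrite -natrX -!natrM ler_nat [leqRHS]mulnC.
Unshelve. all: by end_near. Qed.

End Density.

Theorem corollary1 (R : realType) :
  [/\ cvgn (rho_seq R), cvgn (tau_seq R 4) & cvgn (tau_seq R 5)] /\
  [/\ rho R = tau R 4, 3 / 5 <= tau R 4 & 9 / 13 <= tau R 5].
Proof.
pose a k := density R (fun n => beta (@kings n) k).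
have a_cvg k : cvgn (a k).
  by apply: cvg_density => n m q; exact: beta_kings_blocks.
have tau_cvg k : (tau_seq R k @ \oo --> limn (a k))%classic.
  apply: (cvg_density_sandwich (j := 1)) (a_cvg k) => n n_gt1.
  by rewrite beta_torus_le // addn1 beta_le_torus.
have rho_cvg : (rho_seq R @ \oo --> limn (a 4%N))%classic.
  apply: (cvg_density_sandwich (j := 2)) (a_cvg 4%N) => n n_gt1.
  by rewrite hmax_le_beta addn2 beta_le_hmax.
have tauE k : tau R k = limn (a k) by exact: cvg_lim (tau_cvg k).
split; first by split; apply/cvg_ex; eexists; [exact: rho_cvg | exact: tau_cvg..].
rewrite !tauE; split; first exact: cvg_lim rho_cvg.
  exact: (density_ge (s := 3) (p := 5)) beta4_ge (a_cvg 4%N).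
exact: (density_ge (s := 9) (p := 13)) beta5_ge (a_cvg 5%N).
Qed.
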